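(* Under the hypotheses of Theorem 5 (Part II) stated in the context, let $H$ denote the cdf of the limit $Z_\infty$, where either $c=0$ and $E e^{-\lambda Z_\infty}=\Phi_\rho(\lambda)$, or $c=\infty$ (with $(\mathrm{A}_\alpha)$) and $E e^{-\lambda Z_\infty}=\Phi_\alpha(\lambda)$. Then $H$ belongs to the normal domain of attraction of a stable law with parameter $\rho\in(1/2,1)$; namely, there is a constant $C\in(0,\infty)$ with $1-H(x)\sim C x^{-\rho}$ as $x\to\infty$.
   Context: Standing parameters: $b>0$ (half the offspring variance), $\theta<1/2$, $\rho\in(1/2,1)$ with $\theta+\rho<1$, and $\alpha\in(1/2,1]$. For $a\in(0,1]$ and $\lambda\ge0$, $$\Phi_a(\lambda)=1-\lambda^{\rho-a}(\lambda+1)^{a-\theta-\rho}(a+1-\theta-\rho)B(1-\theta,a+1-\rho)\,I_{\lambda/(\lambda+1)}(a,1-\theta-\rho)-\frac{\lambda\theta}{B(1-\rho,a)}\int_0^1\!\!\int_0^1\frac{u^{1-\rho}(1-u)^{a-1}}{(1-y)^{\rho}(1+\lambda yu)^{\theta+1}}\,dy\,du,$$ where $B$ is the Beta function, $B_x(s,v)=\int_0^x t^{s-1}(1-t)^{v-1}dt$ and $I_x(s,v)=B_x(s,v)/B(s,v)$. Theorem 5 (Part II) asserts that for the critical branching regenerative process with migration $Z_t$ (offspring mean 1, variance $2b$; recurrence parameter $\theta$; cycle initial states with tail $P\{Y^o_{j,0}>x\}\sim x^{-\rho}\ell(x)$; down-periods either of finite mean or with tail $1-A(t)\sim t^{-\alpha}L_A(t)$,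 $E T_{d,1}=\infty$; $c=\lim(1-A(t))/(1-F(t))$ with $F$ the cdf of the cycle lifetime), the limit $Z_\infty$ of $Z_t/(bt)$ (unconditionally if $c<\infty$, conditionally on $Z_t>0$ if $c=\infty$) has Laplace transform $(c+\Phi_\rho)/(c+1)$ if $c<\infty$ and $\Phi_\alpha$ if $c=\infty$. A random variable is in the normal domain of attraction of a positive stable law with parameter $\rho\in(0,1)$ when its tail is asymptotically $Cx^{-\rho}$, $C>0$. *)

(* Defs.v *)
From HB Require Import structures.
From mathcomp Require Import all_boot all_order all_algebra.
From mathcomp Require Import all_classical all_reals all_analysis.
Set Implicit Arguments. Unset Strict Implicit. Unset Printing Implicit Defensive.
Import Order.TTheory GRing.Theory Num.Theory.
Import numFieldNormedType.Exports.
Local Open Scope classical_set_scope.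
Local Open Scope ring_scope.

Section Phi.
Variable R : realType.

Local Notation leb := (@lebesgue_measure R).

Definition betaInc (x s v : R) : R :=
  fine (\int[leb]_(t in `[0%R, x]%classic) ((t `^ (s - 1)) * ((1 - t) `^ (v - 1)))%:E)%E.

Definition betaF (s v : R) : R := betaInc 1 s v.

Definition betaReg (x s v : R) : R := betaInc x s v / betaF s v.

Definition Phi (theta rho a lam : R) : R :=
  1 - lam `^ (rho - a) * (lam + 1) `^ (a - theta - rho)
        * (a + 1 - theta - rho) * betaF (1 - theta) (a + 1 - rho)
        * betaReg (lam / (lam + 1)) a (1 - theta - rho)
    - lam * theta / betaF (1 - rho) a *
      fine (\int[leb]_(u in `[0%R, 1%R]%classic)
              \int[leb]_(y in `[0%R, 1%R]%classic)
                 ((u `^ (1 - rho) * (1 - u) `^ (a - 1))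
                  / ((1 - y) `^ rho * (1 + lam * y * u) `^ (theta + 1)))%:E)%E.

End Phi.

(* Main.v *)
Require Import Defs.
From HB Require Import structures.
From mathcomp Require Import all_boot all_order all_algebra.
From mathcomp Require Import all_classical all_reals all_analysis.
From mathcomp Require Import measurable_realfun ring lra.
Set Implicit Arguments. Unset Strict Implicit. Unset Printing Implicit Defensive.
Import Order.TTheory GRing.Theory Num.Theory.
Import numFieldNormedType.Exports.
Local Open Scope classical_set_scope.
Local Open Scope ring_scope.

(* Near 0 the incomplete Beta function B_x(a, v) behaves like x^a / a and the double
   integral stays bounded, so 1 - Phi(l) ~ K l^rho with K > 0.  The tail is then
   obtained by a Tauberian argument: with y = exp(-l x), the integrals of
   (1 - y)^M y^j (M >= 1), scaled by l^-rho, all converge as l -> 0, being finite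
   differences of 1 - Phi.  For M large, (1 - y)^M is nearly the indicator of
   l x > ln M, which squeezes x^rho mu(]x, +oo[) between two constants whose ratio
   tends to 1; self-similarity in l makes it unnecessary to identify the limit. *)

(** * Tauberian theorem *)

Lemma cvg_at_right0_comp_scale (R : realType) (g : R -> R) (t l : R) : 0 < t ->
  g x @[x --> 0^'+] --> l -> g (t * x) @[x --> 0^'+] --> l.
Proof.
move=> t0 gl; apply: cvg_comp gl => A [e /= e0 eA].
exists (e / t); first by rewrite /= divr_gt0.
move=> x /=; rewrite sub0r normrN => xe x0.
apply: eA => /=; last by rewrite mulr_gt0.
rewrite sub0r normrN normrM (gtr0_norm t0) mulrC.
by rewrite -ltr_pdivlMr.
Qed.

Lemma cvg_at_right0_comp_inv (R : realType) (g : R -> R) (t l : R) : 0 < t ->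
  g x @[x --> 0^'+] --> l -> g (t / x) @[x --> +oo] --> l.
Proof.
move=> t0 gl; apply: cvg_comp gl => A [e /= e0 eA].
exists (t / e); split; first by rewrite num_real.
move=> x ex.
have x0 : 0 < x by rewrite (lt_trans _ ex)// divr_gt0.
apply: eA => /=; last by rewrite divr_gt0.
rewrite sub0r normrN gtr0_norm ?divr_gt0//.
by rewrite ltr_pdivrMr// mulrC -ltr_pdivrMr.
Qed.

Lemma bernoulli_le (R : realType) (n : nat) (u : R) : 0 <= u <= 1 ->
  1 - n%:R * u <= (1 - u) ^+ n.
Proof.
move=> /andP[u0 u1]; elim: n => [|n IH]; first by rewrite mul0r subr0 expr0.
rewrite exprS; apply: (@le_trans _ _ ((1 - u) * (1 - n%:R * u))); last first.
  by rewrite ler_wpM2l// subr_ge0.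
have : 0 <= n%:R * u * u by rewrite !mulr_ge0.
by rewrite -natr1; lra.
Qed.

(** The induction step is (1 - u) (1 + (n + 1) u) <= 1 + n u. It bounds (1 - u)^n by 1 / (1 + n u),
    which is small once n u is large. *)
Lemma bernoulli_ge (R : realType) (n : nat) (u : R) : 0 <= u <= 1 ->
  (1 - u) ^+ n * (1 + n%:R * u) <= 1.
Proof.
move=> /andP[u0 u1]; elim: n => [|n IH]; first by rewrite mul0r addr0 expr0 mulr1.
apply: le_trans IH; rewrite exprSr -mulrA.
apply: ler_wpM2l; first by rewrite exprn_ge0// subr_ge0.
have : 0 <= n%:R * u * u by rewrite !mulr_ge0.
have : 0 <= u * u by rewrite !mulr_ge0.
by rewrite -natr1; lra.
Qed.

(** * Finite differences of the Laplace transform, compared with the tail *)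

Section karamata.
Variables (R : realType) (mu : probability R R).
Local Notation D := (`[0%R, +oo[%classic : set R).
Local Notation tail x := (fine (mu `]x, +oo[%classic)).

(** [laplaceJ 0 1] is the Laplace transform on [D]; increasing [M] takes finite differences in [j],
    and increasing [j] multiplies the argument [l]. *)
Definition laplaceJ (M j : nat) (l : R) : R :=
  \int[mu]_(x in D) ((1 - expR (- (l * x))) ^+ M * expR (- (l * x)) ^+ j).

Lemma itv01_integrable (g : R -> R) : measurable_fun D g ->
  (forall x, 0 <= x -> 0 <= g x <= 1) -> mu.-integrable D (EFin \o g).
Proof.
move=> mg g1; apply: measurable_bounded_integrable => //.
  exact: le_lt_trans (probability_le1 _ _) (ltry _).
exists 1; split; first exact: num_real.
move=> z z1 x /=; rewrite in_itv/= andbT => x0.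
by have /andP[g0 gle] := g1 x x0; rewrite ger0_norm// (le_trans gle)// ltW.
Qed.

Lemma expRN01 (l x : R) : 0 <= l -> 0 <= x -> 0 <= expR (- (l * x)) <= 1.
Proof. by move=> l0 x0; rewrite expR_ge0/= expR_le1 oppr_le0 mulr_ge0. Qed.

Lemma measurable_expRN (l : R) (A : set R) :
  measurable_fun A (fun x : R => expR (- (l * x))).
Proof.
apply: measurable_funTS; apply: measurableT_comp => //.
by apply: measurableT_comp => //; apply: measurable_funM.
Qed.

Lemma laplaceJ_integrable (M j : nat) (l : R) : 0 <= l -> mu.-integrable D
  (EFin \o (fun x => (1 - expR (- (l * x))) ^+ M * expR (- (l * x)) ^+ j)).
Proof.
move=> l0; apply: itv01_integrable.
  apply: measurable_funM; apply: measurable_funX; last exact: measurable_expRN.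
  by apply: measurable_funB => //; exact: measurable_expRN.
move=> x x0; have /andP[e0 e1] := expRN01 l0 x0.
have e0' : 0 <= 1 - expR (- (l * x)) by rewrite subr_ge0.
rewrite mulr_ge0 ?exprn_ge0//= mulr_ile1 ?exprn_ge0 ?exprn_ile1//.
Qed.

Lemma indic_integrable (x : R) :
  mu.-integrable D (EFin \o (\1_(`]x, +oo[%classic) : R -> R)).
Proof.
apply: itv01_integrable; first exact: measurable_indic.
by move=> y _; rewrite indicE ler0n/= lern1 leq_b1.
Qed.

Lemma integrable_EFinZl (c : R) (f : R -> R) : mu.-integrable D (EFin \o f) ->
  mu.-integrable D (EFin \o (fun x => c * f x)).
Proof. by move=> fi; have := integrableZl (measurable_itv _) c fi. Qed.

Lemma integrable_EFinD (f g : R -> R) : mu.-integrable D (EFin \o f) ->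
  mu.-integrable D (EFin \o g) -> mu.-integrable D (EFin \o (fun x => f x + g x)).
Proof. by move=> fi gi; have := integrableD (measurable_itv _) fi gi. Qed.

Lemma laplaceJ_sub (M j : nat) (l : R) : 0 <= l ->
  laplaceJ M.+1 j l = laplaceJ M j l - laplaceJ M j.+1 l.
Proof.
move=> l0; rewrite /laplaceJ -RintegralB//; [|exact: laplaceJ_integrable..].
by apply: eq_Rintegral => x _; rewrite !exprS; ring.
Qed.

Lemma laplaceJ_scale (j : nat) (l : R) :
  laplaceJ 0 j l = laplaceJ 0 1 (j%:R * l).
Proof.
apply: eq_Rintegral => x _; rewrite !expr0 !mul1r expr1 -expRM_natl.
by congr expR; rewrite -!mulrA mulrN.
Qed.

Lemma tailE (x : R) : 0 <= x ->
  \int[mu]_(y in D) \1_(`]x, +oo[%classic) y = tail x.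
Proof.
move=> x0; rewrite /Rintegral integral_indic//; congr (fine (mu _)).
apply/setIidPl => y /=; rewrite !in_itv/= !andbT => /ltW; exact: le_trans.
Qed.

Lemma laplaceJ_ge0 (M j : nat) (l : R) : 0 <= l -> 0 <= laplaceJ M j l.
Proof.
move=> l0; apply: Rintegral_ge0 => x; rewrite /= in_itv/= andbT => x0.
have /andP[e0 e1] := expRN01 l0 x0.
by rewrite mulr_ge0// exprn_ge0// subr_ge0.
Qed.

Lemma tail_ge0 (x : R) : 0 <= tail x.
Proof. exact: fine_ge0. Qed.

(** Beyond [x], Bernoulli bounds the integrand below by 1 - M exp(-l x); elsewhere it is
    nonnegative. *)
Lemma tail_le_laplaceJ (M : nat) (l x d : R) : 0 < l -> 0 <= x -> d <= 1 ->
  M%:R * expR (- (l * x)) <= d -> (1 - d) * tail x <= laplaceJ M 0 l.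
Proof.
move=> l0 x0 d1 Md; rewrite -tailE// -RintegralZl//; last exact: indic_integrable.
apply: le_Rintegral => //.
- by apply: integrable_EFinZl; exact: indic_integrable.
- exact: laplaceJ_integrable (ltW l0).
move=> y /=; rewrite in_itv/= andbT => y0.
have e01 := expRN01 (ltW l0) y0; have /andP[e0 e1] := e01.
rewrite expr0 mulr1 indicE; have [yx|yx] := boolP (y \in _); last first.
  by rewrite mulr0 exprn_ge0// subr_ge0.
rewrite mulr1 (le_trans _ (bernoulli_le M e01))// lerD2l lerN2.
apply: le_trans Md; rewrite ler_wpM2l// ler_expR lerN2 ler_pM2l//.
by move: yx; rewrite inE/= in_itv/= andbT => /ltW.
Qed.

(** Beyond [x] the integrand is at most 1. Up to [x], monotonicity bounds [M] of the factors by
    their value at [x]; the remaining one is kept, because [laplaceJ 1 0 l] is of order l^rho in the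
    application, whereas the total mass is not small. *)
Lemma laplaceJ_le_tail (M : nat) (l x : R) : 0 < l -> 0 <= x ->
  laplaceJ M.+1 0 l <=
    tail x + (1 - expR (- (l * x))) ^+ M * laplaceJ 1 0 l.
Proof.
move=> l0 x0; set c := _ ^+ M.
have c0 : 0 <= c.
  by have /andP[_ ?] := expRN01 (ltW l0) x0; rewrite exprn_ge0// subr_ge0.
have i1 := indic_integrable x.
have i2 := integrable_EFinZl c (laplaceJ_integrable 1 0 (ltW l0)).
rewrite -tailE// -RintegralZl//; last exact: laplaceJ_integrable (ltW l0).
rewrite -RintegralD//.
apply: le_Rintegral => //.
- exact: laplaceJ_integrable (ltW l0).
- exact: integrable_EFinD.
move=> y /=; rewrite in_itv/= andbT => y0.
have /andP[e0 e1] := expRN01 (ltW l0) y0.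
rewrite !expr0 !mulr1 expr1 indicE; set u := expR _ in e0 e1 *.
have u1 : 0 <= 1 - u by rewrite subr_ge0.
have [yx|yx] := boolP (y \in _).
  rewrite (@le_trans _ _ 1)//; first by rewrite exprn_ile1// gerBl.
  by rewrite lerDl mulr_ge0.
rewrite add0r exprSr; apply: ler_wpM2r => //.
apply: lerXn2r; rewrite ?nnegrE//.
  by have /andP[_ ?] := expRN01 (ltW l0) x0; rewrite subr_ge0.
rewrite lerD2l lerN2 ler_expR lerN2 ler_pM2l//.
by move: yx; rewrite notin_setE/= in_itv/= andbT => /negP; rewrite -leNgt.
Qed.

(** * Tail asymptotics when 1 minus the Laplace transform is equivalent to K l^rho *)

Hypothesis muD : mu D = 1%E.
Variables (rho K : R).
Hypothesis rho01 : 0 < rho < 1.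
Hypothesis K0 : 0 < K.
Hypothesis phiK : (1 - laplaceJ 0 1 l) / l `^ rho @[l --> 0^'+] --> K.

Lemma laplaceJ00 (l : R) : laplaceJ 0 0 l = 1.
Proof.
rewrite /laplaceJ; under eq_Rintegral do rewrite !expr0 mulr1.
by rewrite Rintegral_cst// [X in fine X]muD/= mul1r.
Qed.

(** The power [j] is absorbed by replacing [l] with j l, which produces j^rho. The case j = 0 fits
    the formula because [D] has full mass and 0^rho = 0. *)
Lemma cvg_one_sub_laplace (j : nat) :
  (1 - laplaceJ 0 j l) / l `^ rho @[l --> 0^'+] --> j%:R `^ rho * K.
Proof.
have /andP[r0 r1] := rho01.
case: j => [|j].
  rewrite powR0 ?gt_eqF// mul0r.
  under eq_fun do rewrite laplaceJ00 subrr mul0r.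
  exact: cvg_cst.
have j0 : 0 < j.+1%:R :> R by [].
have c := cvg_at_right0_comp_scale j0 phiK.
apply: cvg_trans (cvgM (cvg_cst (j.+1%:R `^ rho)) c); apply: near_eq_cvg; near=> l.
have l0 : 0 < l by near: l; exact: nbhs_right_gt.
rewrite /= (laplaceJ_scale j.+1) powRM ?ltW//.
by field; rewrite ?gt_eqF ?powR_gt0.
Unshelve. all: by end_near. Qed.

Lemma cvg_laplaceJ1 (j : nat) :
  laplaceJ 1 j l / l `^ rho @[l --> 0^'+] -->
   (j.+1%:R `^ rho - j%:R `^ rho) * K.
Proof.
rewrite mulrBl.
apply: cvg_trans (cvgB (@cvg_one_sub_laplace j.+1) (@cvg_one_sub_laplace j)).
apply: near_eq_cvg; near=> l.
have l0 : 0 < l by near: l; exact: nbhs_right_gt.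
rewrite laplaceJ_sub ?ltW//= -mulrBl; congr (_ / _).
by rewrite opprB addrC addrA subrK.
Unshelve. all: by end_near. Qed.

Lemma cvg_laplaceJ10 : laplaceJ 1 0 l / l `^ rho @[l --> 0^'+] --> K.
Proof.
have := @cvg_laplaceJ1 0.
have /andP[r0 r1] := rho01.
by rewrite powR1 powR0 ?gt_eqF// subr0 mul1r.
Qed.

(** The induction starts at one factor 1 - y: without any, the integral does not vanish with [l] and
    the quotient would blow up. Only the existence of the limit is used later. *)
Lemma is_cvg_laplaceJ (M j : nat) :
  exists L : R, laplaceJ M.+1 j l / l `^ rho @[l --> 0^'+] --> L.
Proof.
elim: M j => [|M IH] j; first by eexists; exact: cvg_laplaceJ1.
have [L1 c1] := IH j; have [L2 c2] := IH j.+1; exists (L1 - L2).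
apply: cvg_trans (cvgB c1 c2); apply: near_eq_cvg; near=> l.
have l0 : 0 < l by near: l; exact: nbhs_right_gt.
by rewrite (laplaceJ_sub M.+1) ?ltW//= -mulrBl.
Unshelve. all: by end_near. Qed.

(** One factor suffices: with l = 1 / x, [tail_le_laplaceJ] loses only the constant 1 - exp(-1). *)
Lemma tail_bounded : exists F : R, 0 <= F /\
  \forall x \near +oo, tail x * x `^ rho <= F.
Proof.
have e1 : expR (- 1) < 1 :> R by rewrite expR_lt1 ltrN10.
exists ((K + 1) / (1 - expR (- 1))); split.
  by rewrite divr_ge0 ?subr_ge0 ?ltW// addr_gt0.
have c := cvg_at_right0_comp_inv ltr01 cvg_laplaceJ10.
have : \forall x \near +oo, laplaceJ 1 0 (1 / x) / (1 / x) `^ rho < K + 1.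
  by apply: (cvgr_lt K) => //; rewrite ltrDl.
apply: filterS2 (nbhs_pinfty_gt (num_real 0)) => x x0 h.
rewrite ler_pdivlMr ?subr_gt0//; apply: le_trans (ltW h).
have -> : (1 / x) `^ rho = (x `^ rho)^-1.
  by rewrite div1r -(powR_inv1 (ltW x0)) -powRrM mulN1r powRN.
rewrite invrK.
rewrite mulrAC ler_wpM2r ?powR_ge0// mulrC; apply: tail_le_laplaceJ.
- by rewrite divr_gt0.
- exact: ltW.
- exact: ltW.
- by rewrite divfK ?gt_eqF // mul1r.
Qed.

(** With l = t / x, this turns the normalisation by l^rho into multiplication by x^rho. *)
Lemma powR_scale (t x y : R) : 0 < t -> 0 < x ->
  t `^ rho * (y / (t / x) `^ rho) = x `^ rho * y.
Proof.
move=> t0 x0; rewrite powRM ?invr_ge0 ?ltW// -(powR_inv1 (ltW x0)) -powRrM mulN1r powRN.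
by field; rewrite !gt_eqF ?powR_gt0.
Qed.

(* (1 - exp(-z))^M jumps from 0 to 1 around z = T := ln M, and for M large the jump
   takes place between (1 - eta) T and (1 + eta) T. *)
Lemma tail_squeeze (eta : R) : 0 < eta < 2^-1 -> exists G : R, 0 <= G /\
  \forall x \near +oo,
    (1 - eta) * (tail x * x `^ rho) <= (1 + eta) * G + eta /\
    (1 - eta) * G <= tail x * x `^ rho + eta.
Proof.
move=> /andP[eta0 eta12]; have /andP[r0 r1] := rho01.
(* Since T > X, this choice gives both T > 1 and T eta^3 >= 4 (K + 1), from which all error terms
   below are bounded. *)
pose X := 1 + 4 * (K + 1) / eta ^+ 3.
pose M := Num.bound (expR X); pose T : R := ln M%:R.
have XM : expR X < M%:R by apply: archi_boundP; exact: expR_ge0.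
clearbody M.
have M0 : 0 < M%:R :> R by rewrite (lt_trans _ XM)// expR_gt0.
have eT : expR T = M%:R by rewrite /T lnK.
have XT : X < T by rewrite -ltr_expR eT.
have eta3 : 0 < eta ^+ 3 by rewrite exprn_gt0.
have T1 : 1 < T.
  by rewrite (le_lt_trans _ XT)// /X lerDl divr_ge0// ltW// mulr_gt0// addr_gt0.
have T0 : 0 < T by rewrite (lt_trans _ T1).
have Teta : 4 * (K + 1) <= T * eta ^+ 3.
  by rewrite -ler_pdivrMr// (le_trans _ (ltW XT))// /X lerDr.
(* [q] governs the error on both sides of the jump: M exp(-t1) = q and M exp(-t2) = 1 / q. *)
pose q := expR (- (eta * T)).
have q0 : 0 < q by exact: expR_gt0.
have qq : q * expR (eta * T) = 1 by rewrite /q -expRD addNr expR0.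
(* From exp(z) >= 1 + z^2 / 2 at z = eta T. With the choice of [X] it yields q T (K + 1) <= eta /
   2. *)
have q2 : q * (eta * T) ^+ 2 <= 2.
  have := @expR_ge1Dxn R (eta * T) 1 (mulr_ge0 (ltW eta0) (ltW T0)).
  by move/(ler_wpM2l (ltW q0)); rewrite qq (_ : 2`! = 2)%N//; lra.
have q4 : 4 * (q * T * (K + 1)) <= 2 * eta.
  apply: (@le_trans _ _ (eta * (q * (eta * T) ^+ 2))); last first.
    by rewrite mulrC ler_wpM2r// ltW.
  rewrite [leLHS](_ : _ = q * T * (4 * (K + 1))); last by ring.
  rewrite [leRHS](_ : _ = q * T * (T * eta ^+ 3)); last by ring.
  by rewrite ler_wpM2l// ltW// mulr_gt0.
have qT0 : 0 < q * T by rewrite mulr_gt0.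
have qTK : q * T * K < eta by move: q4; rewrite mulrDr mulr1; lra.
have qT : q <= q * T by rewrite ler_pMr// ltW.
have qTK0 : 0 <= q * T * K by rewrite mulr_ge0// ltW.
have q1 : 2 * q <= eta by move: q4; rewrite mulrDr mulr1; lra.
have [L cL] := is_cvg_laplaceJ M 0.
have L0 : 0 <= L.
  apply: (cvgr_to_ge cL); near=> l; rewrite divr_ge0 ?powR_ge0//.
  by apply: laplaceJ_ge0; apply: ltW; near: l; exact: nbhs_right_gt.
have e10 : 0 < 1 + eta by rewrite addr_gt0.
have e20 : 0 < 1 - eta by lra.
pose t1 := (1 + eta) * T; pose t2 := (1 - eta) * T.
have t10 : 0 < t1 by rewrite mulr_gt0.
have t20 : 0 < t2 by rewrite mulr_gt0.
(* [G] is the limit of x^rho [laplaceJ M.+1 0 (T / x)]. Replacing [T] by [t1] or [t2] costs at most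
   a factor 1 + eta or 1 - eta, because rho <= 1. *)
pose G := T `^ rho * L.
have Tr0 : 0 <= T `^ rho by exact: powR_ge0.
have G0 : 0 <= G by rewrite mulr_ge0.
have u1 : t1 `^ rho * L <= (1 + eta) * G.
  rewrite /t1 (powRM _ (ltW e10) (ltW T0)) -mulrA -/G ler_wpM2r//.
  by apply: ler1_powR; [rewrite lerDl ltW|exact: ltW].
have u2 : (1 - eta) * G <= t2 `^ rho * L.
  rewrite /t2 (powRM _ (ltW e20) (ltW T0)) -mulrA -/G ler_wpM2r//.
  by apply: ger1_powR; [rewrite e20 gerBl ltW|exact: ltW].
have u3 : t2 `^ rho <= T.
  rewrite (@le_trans _ _ (T `^ rho))//; last by apply: ler1_powR; exact: ltW.
  apply: ge0_ler_powR; rewrite ?nnegrE; [exact: ltW|exact: ltW|exact: ltW|].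
  by rewrite /t2 ler_piMl ?gerBl// ltW.
exists G; split => //.
have c1 := cvgM (cvg_cst (t1 `^ rho)) (cvg_at_right0_comp_inv t10 cL).
have c2 := cvgM (cvg_cst (t2 `^ rho)) (cvg_at_right0_comp_inv t20 cL).
have c3 := cvgM (cvg_cst (t2 `^ rho * q)) (cvg_at_right0_comp_inv t20 cvg_laplaceJ10).
have b1 : t1 `^ rho * L < (1 + eta) * G + eta by lra.
have b2 : (1 - eta) * G - eta < t2 `^ rho * L - t2 `^ rho * q * K.
  have : t2 `^ rho * q * K <= q * T * K.
    by rewrite (ler_wpM2r (ltW K0))// mulrC (ler_wpM2l (ltW q0)).
  by lra.
have n1 := cvgr_lt _ (c1 _ _) _ b1.
have n2 := cvgr_gt _ (cvgB (c2 _ _) (c3 _ _)) _ b2.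
near=> x.
have x0 : 0 < x by near: x; exact: nbhs_pinfty_gt.
have : t1 `^ rho * (laplaceJ M.+1 0 (t1 / x) / (t1 / x) `^ rho) <
    (1 + eta) * G + eta by near: x; exact: n1.
have : (1 - eta) * G - eta <
    t2 `^ rho * (laplaceJ M.+1 0 (t2 / x) / (t2 / x) `^ rho) -
    t2 `^ rho * q * (laplaceJ 1 0 (t2 / x) / (t2 / x) `^ rho) by near: x; exact: n2.
rewrite (mulrC (t2 `^ rho) q) -(mulrA q (t2 `^ rho)) !powR_scale// => h2 h1.
have xr0 : 0 <= x `^ rho by exact: powR_ge0.
split.
- apply: ltW; apply: le_lt_trans h1.
  rewrite mulrA mulrC ler_wpM2l//; apply: tail_le_laplaceJ.
  + by rewrite divr_gt0.
  + exact: ltW.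
  + by lra.
  (* There are M + 1 factors, so the loss is (M + 1) exp(-t1) = q (M + 1) / M <= 2 q <= eta. *)
  rewrite divfK ?gt_eqF// /t1 (mulrDl 1 eta T) mul1r opprD expRD -/q expRN eT.
  apply: le_trans q1; rewrite mulrA (ler_wpM2r (ltW q0))// ler_pdivrMr//.
  by rewrite -natr1 mulr_natl mulr2n lerD2l ler1n -(ltr_nat R).
(* Up to [x], the weight (1 - exp(-t2))^M is at most 1 / (1 + 1 / q) <= q, and what it multiplies
   contributes at most about t2^rho q K <= q T K < eta. *)
- have x1 := divr_gt0 t20 x0.
  have := laplaceJ_le_tail M x1 (ltW x0); rewrite divfK ?gt_eqF//.
  have e01 := expRN01 ler01 (ltW t20); rewrite mul1r in e01.
  have := bernoulli_ge M e01.
  have -> : M%:R * expR (- t2) = q^-1.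
    rewrite /t2 (mulrDl 1 (- eta) T) mul1r mulNr opprB expRD expRN eT.
    rewrite mulrCA mulfV ?gt_eqF// mulr1.
    by rewrite -[LHS]mul1r -[X in X * _](mulVf (lt0r_neq0 q0)) -mulrA qq mulr1.
  set c := _ ^+ M; rewrite mulrDr mulr1 => cq.
  have {}cq : c <= q.
    rewrite -[leRHS]mul1r -ler_pdivrMr//; apply: le_trans cq.
    rewrite lerDr exprn_ge0// subr_ge0; by case/andP: e01.
  move=> h; have {h} : laplaceJ M.+1 0 (t2 / x) <= tail x + q * laplaceJ 1 0 (t2 / x).
    by apply: (le_trans h); rewrite lerD2l ler_wpM2r// laplaceJ_ge0// ltW.
  move/(ler_wpM2l xr0); rewrite mulrDr; lra.
Unshelve. all: by end_near. Qed.

(** For each [eta] the squeeze eventually confines the normalised tail near one number [G]. As [G]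
    varies with [eta], the Cauchy criterion is applied instead of naming a limit. *)
Lemma tail_cvg : exists C : R, tail x * x `^ rho @[x --> +oo] --> C.
Proof.
have [F [F0 hF]] := tail_bounded.
suff : cvg (tail x * x `^ rho @[x --> +oo]) by move=> h;
  exists (lim (tail x * x `^ rho @[x --> +oo])).
apply: cauchy_cvg; apply: cauchy_exP => e e0.
(* With eta <= 1/4, the bound [F] on the tail gives G <= 2 F + 1. Both deviations are then at most
   eta (3 F + 2), which is below [e]. *)
pose eta := Num.min (e / (8 * F + 7)) (1 / 4).
have FF : 0 < 8 * F + 7 by lra.
have eta0 : 0 < eta by rewrite /eta lt_min divr_gt0// divr_gt0.
have eta4 : eta <= 1 / 4 by rewrite /eta ge_min lexx orbT.
have etae : eta * (8 * F + 7) <= e by rewrite -ler_pdivlMr// /eta ge_min lexx.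
have [|G [G0 hG]] := @tail_squeeze eta; first by apply/andP; split; lra.
exists G; change (\forall x \near +oo, ball G e (tail x * x `^ rho)).
near=> x; rewrite /ball/=.
have h1 : tail x * x `^ rho <= F by near: x; exact: hF.
have [h2 h3] : (1 - eta) * (tail x * x `^ rho) <= (1 + eta) * G + eta /\
    (1 - eta) * G <= tail x * x `^ rho + eta by near: x; exact: hG.
set f := tail x * _ in h1 h2 h3 *.
have f0 : 0 <= f by rewrite mulr_ge0 ?powR_ge0 ?tail_ge0.
have G2 : G <= 2 * F + 1 by nra.
rewrite ltr_norml; apply/andP; split; nra.
Unshelve. all: by end_near. Qed.

Theorem karamata_tail : exists C : R, 0 < C /\ tail x * x `^ rho @[x --> +oo] --> C.
Proof.
have [C hC] := tail_cvg; exists C; split => //.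
have /andP[r0 r1] := rho01.
have two_lt : 2 `^ rho < 2 :> R.
  have {2}-> : 2 = 2 `^ (1 - rho) * 2 `^ rho :> R.
    by rewrite -powRD ?subrK ?powRr1// pnatr_eq0 implybT.
  rewrite ltr_pMl ?powR_gt0// -[ltLHS](congr1 (fun h => h (1 - rho)) (powR1 R)).
  by apply: gt0_ltr_powR; rewrite ?nnegrE ?subr_gt0 ?ltr1n.
(* Positive because rho < 1. The limit of [laplaceJ 2 0] is 2 s K, and 1 - exp(-s) <= s, so the
   region up to s / l accounts for at most half of it; the tail must supply the rest, whence C >=
   s^rho s K. *)
pose s : R := (2 - 2 `^ rho) / 2.
have s0 : 0 < s by rewrite divr_gt0// subr_gt0.
(* The mass of x <= s / l contributes at most s K to this limit, so C > 0. *)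
have c2 : laplaceJ 2 0 l / l `^ rho @[l --> 0^'+] --> 2 * s * K.
  have -> : 2 * s * K = K - (2 `^ rho - 1 `^ rho) * K.
    by rewrite powR1 /s; field.
  apply: cvg_trans (cvgB cvg_laplaceJ10 (@cvg_laplaceJ1 1)).
  apply: near_eq_cvg; near=> l.
  have l0 : 0 < l by near: l; exact: nbhs_right_gt.
  by rewrite (laplaceJ_sub 1) ?ltW//= -mulrBl.
have d1 := cvgM (cvg_cst (s `^ rho)) (cvg_at_right0_comp_inv s0 c2).
have d2 := cvgM (cvg_cst (s `^ rho * s)) (cvg_at_right0_comp_inv s0 cvg_laplaceJ10).
have : 0 <= C + s `^ rho * s * K - s `^ rho * (2 * s * K).
  apply: (cvgr_to_ge (cvgB (cvgD hC (d2 _ _)) (d1 _ _))); near=> x => /=.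
  have x0 : 0 < x by near: x; exact: nbhs_pinfty_gt.
  have x1 := divr_gt0 s0 x0.
  rewrite subr_ge0 -[leLHS]/(_ * (_ / _)) -[leRHS]/(_ + _ * (_ / _)).
  rewrite (mulrC (s `^ rho) s) -(mulrA s (s `^ rho)) !powR_scale//.
  rewrite (mulrC (tail x)) (mulrCA s) -mulrDr.
  rewrite ler_wpM2l ?powR_ge0//.
  apply: (le_trans (laplaceJ_le_tail 1 x1 (ltW x0))).
  rewrite lerD2l (ler_wpM2r (laplaceJ_ge0 _ _ (ltW x1)))// expr1 divfK ?gt_eqF//.
  by have := expR_ge1Dx (- s); lra.
have : 0 < s `^ rho * s * K by rewrite (mulr_gt0 (mulr_gt0 (powR_gt0 _ s0) s0) K0).
lra.
Unshelve. all: by end_near. Qed.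

End karamata.

(** * Beta integrals *)

(* The integral of a nonnegative function is a supremum over the simple functions
   below it, so the inner integral in [Phi] needs no measurability in [u]. *)
Lemma ge0_le_integral_nomeas d (T : measurableType d) (R : realType)
    (nu : {measure set T -> \bar R}) (D : set T) (f g : T -> \bar R) :
  (forall x, D x -> 0 <= f x)%E -> (forall x, D x -> f x <= g x)%E ->
  (\int[nu]_(x in D) f x <= \int[nu]_(x in D) g x)%E.
Proof.
move=> f0 fg; have g0 x : D x -> (0 <= g x)%E.
  by move=> Dx; exact: le_trans (f0 _ Dx) (fg _ Dx).
rewrite !ge0_integralE//; apply: le_ereal_sup => _ [h hf <-]; exists h => //= x.
by apply: le_trans (hf x) _; rewrite /patch; case: ifPn => // /[!inE]; exact: fg.
Qed.

(** The integrand may blow up at the endpoints, as t^(p - 1) does for p < 1. The fundamental theorem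
    is applied on compact subintervals exhausting the open one, and monotone convergence gives the
    limit. *)
Lemma ge0_FTC_oo (R : realType) (f F : R -> R) (a b : R) : a < b ->
  (forall x, a < x < b -> 0 <= f x) ->
  (forall x, a < x < b -> {for x, continuous f}) ->
  (forall x, a < x < b -> is_derive x 1 F (f x)) ->
  F x @[x --> a^'+] --> F a -> F x @[x --> b^'-] --> F b ->
  (\int[@lebesgue_measure R]_(x in `]a, b[) (f x)%:E = (F b - F a)%:E)%E.
Proof.
move=> ab f0 cf dF Fa Fb.
(* Starting at 3 keeps 2 [d n] < b - a, so that no subinterval is degenerate. *)
pose d n : R := (b - a) / n.+3%:R.
have ba : 0 < b - a by rewrite subr_gt0.
have d0 n : 0 < d n by rewrite divr_gt0.
have d3 n : d n * 3 <= b - a.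
  by rewrite /d mulrAC ler_pdivrMr// ler_wpM2l ?(ltW ba)// ler_nat.
have dd m n : (m <= n)%N -> d n <= d m.
  by move=> mn; rewrite /d ler_wpM2l ?(ltW ba)// lef_pV2 ?posrE// ler_nat !ltnS.
have dlim : d n @[n --> \oo] --> 0.
  rewrite -[X in _ --> X](mulr0 (b - a)); apply: cvgM; first exact: cvg_cst.
  have := @cvg_harmonic R; rewrite -(cvg_shiftn 2) /=.
  by under eq_cvg do rewrite addn2.
pose A n : set R := `[a + d n, b - d n]%classic.
have UA : \bigcup_n A n = `]a, b[%classic.
  apply/seteqP; split=> x.
    move=> [n _]; rewrite /A/= !in_itv/= => /andP[x1 x2]; have := d0 n; lra.
  rewrite /= in_itv/= => /andP[ax xb].
  have e0 : 0 < Num.min (x - a) (b - x) by rewrite lt_min !subr_gt0 ax.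
  have [N _ HN] := cvgr_lt 0 dlim _ e0.
  have := HN N (leqnn N); rewrite /= lt_min => /andP[h1 h2].
  by exists N => //; rewrite /A/= in_itv/=; lra.
have cA n : {within A n, continuous f}.
  apply: continuous_in_subspaceT => x; rewrite inE /A/= in_itv/= => /andP[x1 x2].
  by apply: cf; have := d0 n; lra.
have := @ge0_nondecreasing_set_cvg_integral _ (measurableTypeR R) R A
  (EFin \o f) lebesgue_measure.
rewrite UA => c1.
have {}c1 : (\int[lebesgue_measure]_(x in A i) (f x)%:E)%E @[i --> \oo] -->
    (\int[lebesgue_measure]_(x in `]a, b[) (f x)%:E)%E.
  apply: c1.
  - move=> m n mn; apply/subsetPset => x; rewrite /A/= !in_itv/= => /andP[x1 x2].
    by have := dd _ _ mn; lra.
  - by move=> n; exact: measurable_itv.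
  - move=> n; apply/measurable_EFinP.
    exact: (subspace_continuous_measurable_fun (measurable_itv _) (cA n)).
  - move=> n x; rewrite /A/= in_itv/= => /andP[x1 x2]; rewrite lee_fin; apply: f0.
    by have := d0 n; lra.
have dF' x : a < x < b -> derivable F x 1.
  by move=> h; have h' := dF x h; exact: ex_derive.
have E n : (\int[lebesgue_measure]_(x in A n) (f x)%:E)%E =
    (F (b - d n) - F (a + d n))%:E.
  have dn := d0 n; have d3n := d3 n.
  apply: (continuous_FTC2 _ (cA n)); first by lra.
  - split.
    + move=> x; rewrite in_itv/= => /andP[x1 x2].
      by apply: dF'; lra.
    + apply: cvg_at_right_filter; apply: differentiable_continuous.
      apply/derivable1_diffP.
      by apply: dF'; lra.
    + apply: cvg_at_left_filter; apply: differentiable_continuous.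
      apply/derivable1_diffP.
      by apply: dF'; lra.
  - move=> x; rewrite in_itv/= => /andP[x1 x2].
    have h : is_derive x 1 F (f x) by apply: dF; lra.
    by rewrite derive1E derive_val.
apply: (cvg_unique (@ereal_hausdorff R) c1).
rewrite /=; under eq_cvg do rewrite E.
apply: cvg_EFin; first exact: nearW.
apply: cvgB.
- move/cvg_at_leftP: Fb; apply; split=> [n|]; first by rewrite ltrBlDr ltrDl.
  by rewrite -[X in _ --> X]subr0; apply: cvgB => //; exact: cvg_cst.
- move/cvg_at_rightP: Fa; apply; split=> [n|]; first by rewrite ltrDl.
  by rewrite -[X in _ --> X]addr0; apply: cvgD => //; exact: cvg_cst.
Qed.

(** * Power integrals and the incomplete Beta function near 0 *)

Section powers.
Variable R : realType.
Local Notation leb := (@lebesgue_measure R).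
Implicit Types x t p q v z c w : R.

Lemma continuous_powR p x : 0 < x -> {for x, continuous (fun t => t `^ p)}.
Proof.
move=> x0; apply: differentiable_continuous; apply/derivable1_diffP.
by have h := is_derive1_powR p x0; exact: ex_derive.
Qed.

Lemma integral_powR p x : 0 < p -> 0 < x ->
  (\int[leb]_(t in `[0%R, x]) (t `^ (p - 1))%:E = (x `^ p / p)%:E)%E.
Proof.
move=> p0 x0.
have mf (A : set R) : measurable_fun A (fun t => (t `^ (p - 1))%:E).
  by apply/measurable_EFinP; apply: measurable_funTS; exact: measurable_powR.
rewrite -integral_itv_obnd_cbnd// -integral_itv_bndo_bndc//.
transitivity (p^-1 * x `^ p - p^-1 * 0 `^ p)%:E; last first.
  by rewrite powR0 ?gt_eqF// mulr0 subr0 mulrC.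
apply: (@ge0_FTC_oo R _ (fun t => p^-1 * t `^ p)) => //.
- by move=> t _; exact: powR_ge0.
- by move=> t /andP[t0 _]; exact: continuous_powR.
- move=> t /andP[t0 _]; have h := is_derive1_powR p t0.
  have -> : t `^ (p - 1) = p^-1 *: (p * t `^ (p - 1)).
    by rewrite /GRing.scale/= mulrA mulVf ?mul1r// gt_eqF.
  exact: is_deriveZ.
- rewrite powR0 ?gt_eqF//; apply: cvgM; [exact: cvg_cst|exact: powR_cvg0].
- apply: cvgM; first exact: cvg_cst.
  by apply: cvg_at_left_filter; exact: continuous_powR.
Qed.

Lemma integral_powR_onem q : 0 < q ->
  (\int[leb]_(t in `[0%R, 1%R]) ((1 - t) `^ (q - 1))%:E = (q^-1)%:E)%E.
Proof.
move=> q0.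
have mf (A : set R) : measurable_fun A (fun t => ((1 - t) `^ (q - 1))%:E).
  apply/measurable_EFinP; apply: measurable_funTS.
  apply: (measurableT_comp (measurable_powR (q - 1))).
  exact: measurable_funB.
have c1 t : t < 1 -> {for t, continuous (fun t => (1 - t) `^ q)}.
  move=> t1; apply: (@continuous_comp _ _ _ (fun t => 1 - t) (fun t => t `^ q)).
    by apply: cvgB; [exact: cvg_cst|exact: cvg_id].
  by apply: continuous_powR; rewrite subr_gt0.
rewrite -integral_itv_obnd_cbnd// -integral_itv_bndo_bndc//.
transitivity (- q^-1 * (1 - 1) `^ q - (- q^-1) * (1 - 0) `^ q)%:E; last first.
  by rewrite subrr powR0 ?gt_eqF// mulr0 sub0r subr0 powR1 mulr1 opprK.
apply: (@ge0_FTC_oo R _ (fun t => - q^-1 * (1 - t) `^ q)) => //.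
- by move=> t _; exact: powR_ge0.
- move=> t /andP[_ t1].
  apply: (@continuous_comp _ _ _ (fun t => 1 - t) (fun t => t `^ (q - 1))).
    by apply: cvgB; [exact: cvg_cst|exact: cvg_id].
  by apply: continuous_powR; rewrite subr_gt0.
- move=> t /andP[_ t1].
  have t10 : 0 < 1 - t by rewrite subr_gt0.
  have h := is_derive1_powR q t10.
  have h' : is_derive t 1 (fun t : R => 1 - t) (- 1).
    by rewrite -[X in is_derive _ _ _ X]sub0r; exact: is_deriveB.
  have -> : (1 - t) `^ (q - 1) = (- q^-1) *: (q * (1 - t) `^ (q - 1) * -1).
    by rewrite /GRing.scale/=; field; rewrite gt_eqF.
  have h2 : is_derive t 1 (fun t : R => (1 - t) `^ q) (q * (1 - t) `^ (q - 1) * -1).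
    exact: (@is_derive1_comp R (fun y => y `^ q) (fun y => 1 - y) t _ _ h h').
  exact: is_deriveZ.
- apply: cvgM; first exact: cvg_cst.
  by apply: cvg_at_right_filter; exact: c1.
- rewrite subrr powR0 ?gt_eqF//; apply: cvgM; first exact: cvg_cst.
  have /(_ _) := @powR_cvg0 R q q0; apply: cvg_comp.
  move=> A [e /= e0 eA]; exists e => //= t te t1.
  apply: eA => /=; last by rewrite subr_gt0.
  by rewrite sub0r normrN.
Qed.

Lemma integral_powRZ k p x : 0 <= k -> 0 < p -> 0 < x ->
  (\int[leb]_(t in `[0%R, x]) (k%:E * (t `^ (p - 1))%:E) =
   (k * (x `^ p / p))%:E)%E.
Proof.
move=> k0 p0 x0; rewrite ge0_integralZl_EFin//; first by rewrite integral_powR.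
  by move=> t _; rewrite lee_fin powR_ge0.
by apply/measurable_EFinP; apply: measurable_funTS; exact: measurable_powR.
Qed.

Lemma integral_powR_onemZ k q : 0 <= k -> 0 < q ->
  (\int[leb]_(t in `[0%R, 1%R]) (k%:E * ((1 - t) `^ (q - 1))%:E) = (k / q)%:E)%E.
Proof.
move=> k0 q0; rewrite ge0_integralZl_EFin//; first by rewrite integral_powR_onem.
  by move=> t _; rewrite lee_fin powR_ge0.
apply/measurable_EFinP; apply: measurable_funTS.
by apply: (measurableT_comp (measurable_powR (q - 1))); exact: measurable_funB.
Qed.

(** The absolute value treats exponents of either sign at once: z^w is z^|w| or its inverse, and
    z^|w| lies between c^|w| and 1. *)
Lemma powR_bounds c z w : 0 < c -> c <= z -> z <= 1 ->
  c `^ `|w| <= z `^ w <= c `^ (- `|w|).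
Proof.
move=> c0 cz z1; have z0 := lt_le_trans c0 cz.
have cW : c `^ `|w| <= z `^ `|w| by apply: ge0_ler_powR => //; rewrite nnegrE ltW.
have zW : z `^ `|w| <= 1.
  by rewrite -[leRHS](powRr0 z); apply: ger_powR; rewrite ?z0.
have cW0 : 0 < c `^ `|w| by exact: powR_gt0.
have zW0 : 0 < z `^ `|w| by exact: powR_gt0.
have [w0|w0] := leP 0 w.
  move: cW zW cW0 zW0; rewrite ger0_norm// => cW zW cW0 zW0.
  by rewrite cW/= (le_trans zW)// powRN invf_ge1// (le_trans cW).
have -> : z `^ w = (z `^ `|w|)^-1 by rewrite (ltr0_norm w0) powRN invrK.
rewrite powRN lef_pV2 ?posrE// cW andbT.
by rewrite (le_trans (le_trans cW zW))// invf_ge1//.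
Qed.

Lemma measurable_beta_integrand p v (A : set R) :
  measurable_fun A (fun t => ((t `^ (p - 1)) * ((1 - t) `^ (v - 1)))%:E).
Proof.
apply/measurable_EFinP; apply: measurable_funTS; apply: measurable_funM.
  exact: measurable_powR.
by apply: (measurableT_comp (measurable_powR (v - 1))); exact: measurable_funB.
Qed.

Lemma beta_integral_lty p q : 0 < p -> 0 < q ->
  (\int[leb]_(t in `[0%R, 1%R]) ((t `^ (p - 1)) * ((1 - t) `^ (q - 1)))%:E < +oo)%E.
Proof.
move=> p0 q0.
(* On each side of 1/2 only one factor can be singular; the other is at most [c1] or [c2]. The sum
   of the two one-sided bounds dominates everywhere. *)
pose c1 : R := 2^-1 `^ (- `|q - 1|); pose c2 : R := 2^-1 `^ (- `|p - 1|).
have h0 : 0 < 2^-1 :> R by [].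
apply: (@le_lt_trans _ _ (\int[leb]_(t in `[0%R, 1%R])
    (c1%:E * (t `^ (p - 1))%:E + c2%:E * ((1 - t) `^ (q - 1))%:E))%E).
  apply: ge0_le_integral_nomeas => t; rewrite /= in_itv/= => /andP[t0 t1].
    by rewrite lee_fin mulr_ge0// powR_ge0.
  rewrite -!EFinM -EFinD lee_fin; have [th|th] := leP t 2^-1.
    have /andP[_ h] : 2^-1 `^ `|q - 1| <= (1 - t) `^ (q - 1) <= c1.
      by apply: powR_bounds => //; lra.
    rewrite [leRHS]addrC ler_wpDl ?mulr_ge0 ?powR_ge0//.
    by rewrite mulrC ler_wpM2r ?powR_ge0.
  have /andP[_ h] : 2^-1 `^ `|p - 1| <= t `^ (p - 1) <= c2.
    by apply: powR_bounds => //; exact: ltW.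
  rewrite ler_wpDl ?mulr_ge0 ?powR_ge0//.
  by rewrite ler_wpM2r ?powR_ge0.
have m1 (A : set R) : measurable_fun A (fun t => (t `^ (p - 1))%:E).
  by apply/measurable_EFinP; apply: measurable_funTS; exact: measurable_powR.
have m2 (A : set R) : measurable_fun A (fun t => ((1 - t) `^ (q - 1))%:E).
  apply/measurable_EFinP; apply: measurable_funTS.
  by apply: (measurableT_comp (measurable_powR (q - 1))); exact: measurable_funB.
rewrite ge0_integralD//=; first
  by rewrite integral_powRZ ?powR_ge0// integral_powR_onemZ ?powR_ge0// -EFinD ltry.
- by move=> t _; rewrite -EFinM lee_fin mulr_ge0 ?powR_ge0.
- exact: (measurable_funeM _ (m1 _)).
- by move=> t _; rewrite -EFinM lee_fin mulr_ge0 ?powR_ge0.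
- exact: (measurable_funeM _ (m2 _)).
Qed.

(** On [0, x] the factor (1 - t)^(v - 1) stays between two powers of 1 - x, leaving the integral of
    t^(p - 1). *)
Lemma betaInc_bounds p v x : 0 < p -> 0 < x < 1 ->
  (1 - x) `^ `|v - 1| * (x `^ p / p) <= betaInc x p v <=
  (1 - x) `^ (- `|v - 1|) * (x `^ p / p).
Proof.
move=> p0 /andP[x0 x1].
have b t : 0 <= t <= x ->
    (1 - x) `^ `|v - 1| <= (1 - t) `^ (v - 1) <= (1 - x) `^ (- `|v - 1|).
  by move=> /andP[t0 tx]; apply: powR_bounds; lra.
have L : (((1 - x) `^ `|v - 1| * (x `^ p / p))%:E <=
    \int[leb]_(t in `[0%R, x]) ((t `^ (p - 1)) * ((1 - t) `^ (v - 1)))%:E)%E.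
  rewrite -integral_powRZ ?powR_ge0//; apply: ge0_le_integral_nomeas => t;
    rewrite /= in_itv/= => tx.
    by rewrite -EFinM lee_fin mulr_ge0 ?powR_ge0.
  have /andP[h _] := b t tx.
  by rewrite -EFinM lee_fin mulrC ler_wpM2l ?powR_ge0.
have U : (\int[leb]_(t in `[0%R, x]) ((t `^ (p - 1)) * ((1 - t) `^ (v - 1)))%:E <=
    ((1 - x) `^ (- `|v - 1|) * (x `^ p / p))%:E)%E.
  rewrite -integral_powRZ ?powR_ge0//; apply: ge0_le_integral_nomeas => t;
    rewrite /= in_itv/= => tx.
    by rewrite lee_fin mulr_ge0 ?powR_ge0.
  have /andP[_ h] := b t tx.
  by rewrite -EFinM lee_fin [leRHS]mulrC ler_wpM2l ?powR_ge0.
have fin : (\int[leb]_(t in `[0%R, x]) ((t `^ (p - 1)) * ((1 - t) `^ (v - 1)))%:E)%E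
    \is a fin_num.
  rewrite ge0_fin_numE; first exact: le_lt_trans U (ltry _).
  apply: le_trans L; rewrite lee_fin mulr_ge0 ?powR_ge0// divr_ge0 ?powR_ge0//.
  exact: ltW.
by rewrite -!lee_fin /betaInc fineK// L.
Qed.

Lemma betaF_gt0 p q : 0 < p -> 0 < q -> 0 < betaF p q.
Proof.
move=> p0 q0.
have h01 : 0 < (2^-1 : R) < (1 : R) by rewrite invr_gt0 ltr0n invf_lt1 ?ltr1n.
have /andP[h _] := betaInc_bounds q p0 h01.
apply: (@lt_le_trans _ _ (betaInc 2^-1 p q)).
  apply: lt_le_trans h; rewrite mulr_gt0 ?divr_gt0 ?powR_gt0//; lra.
have ge0 (y : R) :
    (0 <= \int[leb]_(t in `[0%R, y]) ((t `^ (p - 1)) * ((1 - t) `^ (q - 1)))%:E)%E.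
  by apply: integral_ge0 => t _; rewrite lee_fin mulr_ge0 ?powR_ge0.
have le1 : (\int[leb]_(t in `[0%R, (2^-1)%R]) ((t `^ (p - 1)) * ((1 - t) `^ (q - 1)))%:E <=
    \int[leb]_(t in `[0%R, 1%R]) ((t `^ (p - 1)) * ((1 - t) `^ (q - 1)))%:E)%E.
  apply: ge0_subset_integral => //; first exact: measurable_beta_integrand.
    by move=> t _; rewrite lee_fin mulr_ge0 ?powR_ge0.
  move=> t; rewrite /= !in_itv/= => /andP[-> /le_trans]; apply; lra.
(* Finiteness matters: [fine] sends +oo to 0, which would destroy positivity. *)
have lty := beta_integral_lty p0 q0.
rewrite /betaF /betaInc fine_le//.
- by rewrite ge0_fin_numE// (le_lt_trans le1).
- by rewrite ge0_fin_numE.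
Qed.

Lemma cvg_powR_near1 (e c : R) : ((1 + e * x) `^ c) @[x --> 0^'+] --> (1 : R).
Proof.
apply: cvg_at_right_filter.
suff : (1 + e * x) `^ c @[x --> 0] --> (1 + e * 0) `^ c.
  by rewrite mulr0 addr0 powR1.
apply: (@continuous_comp _ _ _ (fun x => 1 + e * x) (fun y => y `^ c) 0).
  apply: cvgD; first exact: cvg_cst.
  by apply: cvgM; [exact: cvg_cst|exact: cvg_id].
by apply: continuous_powR; rewrite mulr0 addr0.
Qed.

Lemma cvg_betaInc p v : 0 < p -> betaInc x p v / x `^ p @[x --> 0^'+] --> p^-1.
Proof.
move=> p0.
have b : \forall x \near 0^'+,
    (1 + (-1) * x) `^ `|v - 1| * p^-1 <= betaInc x p v / x `^ p <=
    (1 + (-1) * x) `^ (- `|v - 1|) * p^-1.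
  near=> x.
  have x0 : 0 < x by near: x; exact: nbhs_right_gt.
  have x1 : x < 1 by near: x; exact: nbhs_right_lt.
  have := @betaInc_bounds p v x p0; rewrite x0 x1 => /(_ isT) /andP[h1 h2].
  by rewrite mulN1r ler_pdivlMr ?powR_gt0// ler_pdivrMr ?powR_gt0// -!mulrA
    !(mulrC p^-1) h1 h2.
rewrite -[p^-1]mul1r.
apply: (squeeze_cvgr b).
  by apply: cvgM; [exact: cvg_powR_near1|exact: cvg_cst].
by apply: cvgM; [exact: cvg_powR_near1|exact: cvg_cst].
Unshelve. all: by end_near. Qed.

End powers.

(** * Behaviour of Phi at 0 *)

Section Phi_at_zero.
Variable R : realType.
Local Notation leb := (@lebesgue_measure R).

(** Repeats the double integral of [Phi] literally, so that it can be folded there. *)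
Definition Phi_integral (theta rho a lam : R) : R :=
  fine (\int[leb]_(u in `[0%R, 1%R]%classic)
          \int[leb]_(y in `[0%R, 1%R]%classic)
             ((u `^ (1 - rho) * (1 - u) `^ (a - 1))
              / ((1 - y) `^ rho * (1 + lam * y * u) `^ (theta + 1)))%:E)%E.

(** For 0 < lam <= 1 the base 1 + lam y u lies in [1, 2], so its power is bounded; what remains is
    dominated by a product of two integrals of powers of 1 - y and 1 - u. *)
Lemma Phi_integral_bounded (theta rho a : R) : rho < 1 -> 0 < a ->
  exists C : R, forall lam, 0 < lam -> lam <= 1 ->
    0 <= Phi_integral theta rho a lam <= C.
Proof.
move=> r1 a0; pose c : R := 2^-1 `^ (- `|theta + 1|).
have c0 : 0 <= c by exact: powR_ge0.
have r10 : 0 < 1 - rho by rewrite subr_gt0.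
exists (c / (1 - rho) / a) => lam lam0 lam1.
have pos (u y : R) : (0 <= ((u `^ (1 - rho) * (1 - u) `^ (a - 1))
    / ((1 - y) `^ rho * (1 + lam * y * u) `^ (theta + 1)))%:E)%E.
  by rewrite lee_fin divr_ge0// mulr_ge0 ?powR_ge0.
have posI : (0 <= \int[leb]_(u in `[0%R, 1%R]%classic)
          \int[leb]_(y in `[0%R, 1%R]%classic)
             ((u `^ (1 - rho) * (1 - u) `^ (a - 1))
              / ((1 - y) `^ rho * (1 + lam * y * u) `^ (theta + 1)))%:E)%E.
  by apply: integral_ge0 => u _; exact: integral_ge0.
have inner (u : R) : 0 <= u <= 1 ->
    (\int[leb]_(y in `[0%R, 1%R]%classic)
             ((u `^ (1 - rho) * (1 - u) `^ (a - 1))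
              / ((1 - y) `^ rho * (1 + lam * y * u) `^ (theta + 1)))%:E <=
     (c / (1 - rho))%:E * ((1 - u) `^ (a - 1))%:E)%E.
  move=> /andP[u0 u1].
  rewrite -EFinM mulrAC -integral_powR_onemZ ?mulr_ge0 ?powR_ge0//.
  apply: ge0_le_integral_nomeas => // y; rewrite /= in_itv/= => /andP[y0 y1].
  rewrite -EFinM lee_fin invfM -powRN.
  have -> : 1 - rho - 1 = - rho by ring.
  rewrite (mulrC ((1 - y) `^ _)) mulrA ler_wpM2r ?powR_ge0//.
  have uy0 : 0 <= lam * y * u by rewrite !mulr_ge0// ltW.
  have uy1 : lam * y * u <= 1 by rewrite !mulr_ile1 ?mulr_ge0// ltW.
  have s0 : 0 < 1 + lam * y * u by lra.
  have -> : ((1 + lam * y * u) `^ (theta + 1))^-1 = (1 + lam * y * u)^-1 `^ (theta + 1).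
    by rewrite -(powR_inv1 (ltW s0)) -powRrM mulN1r powRN.
  have /andP[_ h] : 2^-1 `^ `|theta + 1| <= (1 + lam * y * u)^-1 `^ (theta + 1) <= c.
    apply: powR_bounds => //; first by rewrite lef_pV2 ?posrE//; lra.
    by rewrite invf_le1//; lra.
  have hu : u `^ (1 - rho) <= 1.
    rewrite -[leRHS](congr1 (fun h => h (1 - rho)) (powR1 R)).
    by apply: ge0_ler_powR; rewrite ?nnegrE// ltW.
  rewrite [leLHS]mulrC ler_pM ?mulr_ge0 ?powR_ge0//.
  by rewrite -[leRHS]mul1r ler_wpM2r ?powR_ge0.
have outer : (\int[leb]_(u in `[0%R, 1%R]%classic)
          \int[leb]_(y in `[0%R, 1%R]%classic)
             ((u `^ (1 - rho) * (1 - u) `^ (a - 1))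
              / ((1 - y) `^ rho * (1 + lam * y * u) `^ (theta + 1)))%:E <=
       (c / (1 - rho) / a)%:E)%E.
  rewrite -integral_powR_onemZ ?divr_ge0 ?(ltW r10)//.
  apply: ge0_le_integral_nomeas => u; rewrite /= in_itv/= => u01; last exact: inner.
  exact: integral_ge0.
rewrite /Phi_integral fine_ge0//= -lee_fin fineK//.
by rewrite ge0_fin_numE// (le_lt_trans outer)// ltry.
Qed.

(** The incomplete Beta factor contributes lam^a / a, which cancels the -a in lam^(rho - a) and
    leaves order lam^rho for every [a]. The double integral term is O(lam), negligible since rho <
    1. *)
Lemma cvg_one_sub_Phi (theta rho a : R) : theta < 1 -> rho < 1 ->
  theta + rho < 1 -> 0 < a ->
  exists K : R, 0 < K /\
    (1 - Phi theta rho a lam) / lam `^ rho @[lam --> 0^'+] --> K.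
Proof.
move=> t1 r1 tr1 a0.
pose v := 1 - theta - rho.
have v0 : 0 < v by rewrite /v; lra.
pose k1 := (a + 1 - theta - rho) * betaF (1 - theta) (a + 1 - rho) / betaF a v.
have k10 : 0 < k1.
  by rewrite divr_gt0 ?mulr_gt0 ?betaF_gt0//; lra.
exists (k1 / a); split; first by rewrite divr_gt0.
pose k2 := theta / betaF (1 - rho) a.
have [C hC] := Phi_integral_bounded theta r1 a0.
have x0 : (fun l : R => l / (l + 1)) @ 0^'+ `=>` 0^'+.
  move=> A [e /= e0 eA]; exists e => //= l; rewrite /ball_/= sub0r normrN => le l0.
  have l10 : 0 < l + 1 by rewrite addr_gt0.
  apply: eA => /=; last by rewrite divr_gt0.
  rewrite sub0r normrN gtr0_norm ?divr_gt0// (le_lt_trans _ le)// gtr0_norm//.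
  by rewrite ler_pdivrMr// ler_peMr ?(ltW l0)// lerDr ltW.
(* The exponent a - theta - rho of l + 1 loses its [a] to the denominator of (l / (l + 1))^a. *)
have d1 : (1 + 1 * l) `^ (- theta - rho) * (k1 *
    (betaInc (l / (l + 1)) a v / (l / (l + 1)) `^ a)) @[l --> 0^'+] --> k1 / a.
  rewrite -[k1 / a]mul1r; apply: cvgM; first exact: cvg_powR_near1.
  apply: cvgM; first exact: cvg_cst.
  exact: (cvg_comp _ _ x0 (@cvg_betaInc R a v a0)).
have d2 : l `^ (1 - rho) * (k2 * Phi_integral theta rho a l) @[l --> 0^'+] --> 0.
  have p0 : l `^ (1 - rho) @[l --> (0:R)^'+] --> 0 by apply: powR_cvg0; rewrite subr_gt0.
  (* [theta], hence [k2], may have either sign, so the squeeze is two-sided. *)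
  apply: (@squeeze_cvgr _ _ _ _ (fun l => l `^ (1 - rho) * - (`|k2| * C))
    (fun l => l `^ (1 - rho) * (`|k2| * C))).
  - near=> l.
    have l0 : 0 < l by near: l; exact: nbhs_right_gt.
    have l1 : l <= 1 by near: l; exact: nbhs_right_le.
    have /andP[h1 h2] := hC l l0 l1.
    have : `|k2 * Phi_integral theta rho a l| <= `|k2| * C.
      by rewrite normrM ler_wpM2l// ger0_norm.
    by rewrite ler_norml => /andP[h3 h4]; rewrite !ler_wpM2l ?powR_ge0.
  - by rewrite -[X in _ --> X](mul0r (- (`|k2| * C))); apply: cvgM => //; exact: cvg_cst.
  - by rewrite -[X in _ --> X](mul0r (`|k2| * C)); apply: cvgM => //; exact: cvg_cst.
rewrite -[k1 / a]addr0; apply: cvg_trans (cvgD d1 d2).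
apply: near_eq_cvg; near=> l.
have l0 : 0 < l by near: l; exact: nbhs_right_gt.
have l10 : 0 < l + 1 by rewrite addr_gt0.
have ln : l != 0 by rewrite gt_eqF.
have l1n : l + 1 != 0 by rewrite gt_eqF.
rewrite /Phi -/(Phi_integral theta rho a l) /betaReg -/v -[LHS]/(_ * _ + _ * _)/=.
have -> : (l / (l + 1)) `^ a = l `^ a / (l + 1) `^ a.
  by rewrite powRM ?invr_ge0 ?(ltW l0) ?(ltW l10)// -(powR_inv1 (ltW l10))
    -powRrM mulN1r powRN.
rewrite mul1r (addrC 1 l).
have -> : l `^ (rho - a) = l `^ rho / l `^ a by rewrite powRB// ln implybT.
have -> : (l + 1) `^ (a - theta - rho) = (l + 1) `^ a * (l + 1) `^ (- theta - rho).
  by rewrite -powRD; [congr (_ `^ _); ring|rewrite l1n implybT].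
have -> : l `^ (1 - rho) = l / l `^ rho by rewrite powRB ?powRr1 ?(ltW l0)// ln implybT.
rewrite /k1 /k2; set B1 := betaF (1 - theta) _; set B2 := betaF a v.
set B3 := betaF (1 - rho) a; set D := Phi_integral _ _ _ _.
have B20 : B2 != 0 by rewrite gt_eqF// betaF_gt0.
have B30 : B3 != 0 by rewrite gt_eqF// betaF_gt0// subr_gt0.
by field; rewrite B20 B30 !(gt_eqF (powR_gt0 _ _)).
Unshelve. all: by end_near. Qed.

End Phi_at_zero.

(* mu = law of Z_infty (a probability on R, carried by [0, +oo));
   H(x) = mu(]-oo, x]), so 1 - H(x) = mu(]x, +oo[).
   a = rho (case c = 0) or a = alpha (case c = oo). *)
Theorem theorem5 (R : realType) (theta rho alpha a : R)
  (htheta : theta < 2^-1) (hrho1 : 2^-1 < rho) (hrho2 : rho < 1)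
  (hthrho : theta + rho < 1) (halpha1 : 2^-1 < alpha) (halpha2 : alpha <= 1)
  (ha : a = rho \/ a = alpha)
  (mu : probability R R)
  (hnonneg : mu `]-oo, 0%R[%classic = 0%E)
  (hLT : forall lam : R, 0 <= lam ->
     (\int[mu]_x (expR (- lam * x))%:E)%E = (Phi theta rho a lam)%:E) :
  exists C : R, 0 < C /\
    (fun x : R => fine (mu `]x, +oo[%classic) * x `^ rho) @ +oo --> C.
Proof.
have a0 : 0 < a by case: ha => ->; lra.
have t1 : theta < 1 by lra.
have r0 : 0 < rho by lra.
have [K [K0 cK]] := cvg_one_sub_Phi t1 hrho2 hthrho a0.
have DE : (`[0%R, +oo[%classic : set R) = ~` `]-oo, 0%R[%classic.
  by rewrite setCitvl.
have muD : mu (`[0%R, +oo[%classic : set R) = 1%E.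
  by rewrite DE probability_setC// hnonneg sube0.
have LPhi (l : R) : 0 <= l -> laplaceJ mu 0 1 l = Phi theta rho a l.
  move=> l0; rewrite /laplaceJ /Rintegral.
  rewrite -[RHS]/(fine (Phi theta rho a l)%:E) -hLT//.
  (* The transform is given over the whole line; discarding the null set of negative reals restricts
     it to the half-line of [laplaceJ]. *)
  rewrite [in RHS](@ge0_negligible_integral _ _ R mu setT
    (`]-oo, 0%R[%classic : set R))//.
  - rewrite setTD -DE; congr fine; apply: eq_integral => x _.
    by rewrite expr0 mul1r expr1 mulNr.
  - by apply/measurable_EFinP; apply: measurableT_comp.
apply: (@karamata_tail R mu muD rho K) => //; first by rewrite r0.
apply: cvg_trans cK; apply: near_eq_cvg; near=> l.
have l0 : 0 < l by near: l; exact: nbhs_right_gt.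
by rewrite LPhi// ltW.
Unshelve. all: by end_near. Qed.
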